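(* Let $\mathcal I\subset\mathrm{Int}(\mathbb R^d)$ be any collection of intervals that is closed under thickenings and ZIB-rank-representing. Then, for any $\mathbb R^d$-modules $M$ and $N$, $$d_{\mathrm E}(M_{\mathbb{ZZ}_{\mathcal I}},N_{\mathbb{ZZ}_{\mathcal I}})\le d_{\mathrm I}(M,N).$$
   Context: Fix a field $k$; $\mathbf{vec}$ is the category of finite-dimensional $k$-vector spaces. A poset is regarded as a category; a $P$-module is a functor $M:P\to\mathbf{vec}$, with structure maps $\varphi_M(a,b)$. $\mathbb R^d$ carries the product order. An interval of $P$ is a nonempty $I\subset P$ that is convex ($p,r\in I$, $p\le q\le r$ imply $q\in I$) and connected (any two elements of $I$ are joined by a finite sequence in $I$ whose consecutive elements are comparable). $\mathrm{Int}(P)$ is the set of intervals. For a connected poset $P$ and a $P$-module $M$, $\mathrm{rk}(M)$ is the rank of the canonical map $\varprojlim M\to\varinjlim M$ ($i_p\circ\pi_p$ for any $p$, with $\pi_p,i_p$ the structure maps). A path in $P$ is a nonempty finite sequence $\Gamma:p_1,\dots,p_n$ in $P$ with $p_i\le p_{i+1}$ or $p_{i+1}\le p_i$ for each $i$ (repetitions allowed); it is viewed as a zigzag poset $p_1\leftrightarrow p_2\leftrightarrow\cdots\leftrightarrow p_n$ on $n$ points (each $\leftrightarrow$ being $\le$ or $\ge$), and $M_\Gamma$ is the zigzag module obtained by pulling back $M$. Zigzag modules are interval-decomposable, and $\mathrm{barc}(M_\Gamma)$ is the multiset of intervals of the zigzag poset appearing in the decomposition; $\mathrm{rk}(M_\Gamma)$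 equals the multiplicity of the full bar in it. A path $\Gamma$ in $P$ is rank-representing (for $P$) if $\mathrm{rk}(M)=\mathrm{rk}(M_\Gamma)$ for every $P$-module $M$. $\mathcal I\subset\mathrm{Int}(P)$ is ZIB-rank-representing if each $I\in\mathcal I$ admits at least one rank-representing path in $I$. Put $\mathbb{ZZ}_{\mathcal I}:=\{\Gamma:\Gamma$ is a rank-representing path for some $I\in\mathcal I\}$, and let $M_{\mathbb{ZZ}_{\mathcal I}}$ be the map $\Gamma\mapsto\mathrm{barc}(M_\Gamma)$ on $\mathbb{ZZ}_{\mathcal I}$. Thickening: $I^\epsilon:=\{p\in\mathbb R^d:\exists q\in I,\ \|p-q\|_\infty\le\epsilon\}$; $\mathcal I$ is closed under thickenings if $I^\epsilon\in\mathcal I$ for all $I\in\mathcal I$, $\epsilon\ge0$. For $\Gamma\in\mathbb{ZZ}_{\mathcal I}$ rank-representing for $I\in \mathcal I$, $\Gamma^\epsilon$ denotes any rank-representing path for $I^\epsilon$. $d_{\mathrm E}(M_{\mathbb{ZZ}_{\mathcal I}},N_{\mathbb{ZZ}_{\mathcal I}})$ is the infimum of $\epsilon\ge0$ such that for all $\Gamma\in\mathbb{ZZ}_{\mathcal I}$, $\mathrm{rk}(M_{\Gamma^\epsilon})\le\mathrm{rk}(N_\Gamma)$ and $\mathrm{rk}(N_{\Gamma^\epsilon})\le\mathrm{rk}(M_\Gamma)$ ($\infty$ if none). Interleaving distance: with $\vec\epsilon=\epsilon(1,\dots,1)$, $M^{\vec\epsilon}(a)=M(a+\vec\epsilon)$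 with the corresponding maps, $\alpha(\vec\epsilon)_a=\alpha_{a+\vec\epsilon}$, and $\varphi_M^{\vec\epsilon}:M\to M^{\vec\epsilon}$ with components $\varphi_M(a,a+\vec\epsilon)$, $M,N$ are $\epsilon$-interleaved if there are morphisms $\alpha:M\to N^{\vec\epsilon}$, $\beta:N\to M^{\vec\epsilon}$ with $\beta(\vec\epsilon)\circ\alpha=\varphi_M^{2\vec\epsilon}$ and $\alpha(\vec\epsilon)\circ\beta=\varphi_N^{2\vec\epsilon}$; $d_{\mathrm I}(M,N)$ is the infimum of such $\epsilon\ge0$ ($\infty$ if none). *)

(* Defs.v *)
From HB Require Import structures.
From mathcomp Require Import all_boot all_order all_algebra.
From mathcomp Require Import all_classical all_reals all_analysis.
From mathcomp Require Import zify.

Set Implicit Arguments.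
Unset Strict Implicit.
Unset Printing Implicit Defensive.

Import Order.TTheory GRing.Theory Num.Theory.
Import numFieldNormedType.Exports.

Local Open Scope classical_set_scope.
Local Open Scope ring_scope.

Record pmodule (k : fieldType) (disp : Order.disp_t) (P : porderType disp) :=
  PModule {
    pspace :> P -> vectType k;
    smap : forall a b : P, (a <= b)%O -> 'Hom(pspace a, pspace b);
    smap_id : forall a, smap (lexx a) = \1%VF;
    smap_comp : forall a b c (ab : (a <= b)%O) (bc : (b <= c)%O),
      smap (le_trans ab bc) = (smap bc \o smap ab)%VF
  }.
Arguments smap {k disp P} p {a b}.

Record pmorphism (k : fieldType) (disp : Order.disp_t) (P : porderType disp)
    (M N : pmodule k P) := PMorphism {
  pmor :> forall a : P, 'Hom(M a, N a);
  pmor_nat : forall a b (ab : (a <= b)%O),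
    (pmor b \o smap M ab)%VF = (smap N ab \o pmor a)%VF
}.

Section Pullback.
Context (k : fieldType) (disp disp' : Order.disp_t).
Context (Q : porderType disp) (P : porderType disp').
Context (f : Q -> P) (f_homo : {homo f : a b / (a <= b)%O}) (M : pmodule k P).

Let pull_map (a b : Q) (ab : (a <= b)%O) : 'Hom(M (f a), M (f b)) :=
  smap M (f_homo ab).

Fact pull_map_id (a : Q) : pull_map (lexx a) = \1%VF.
Proof.
rewrite /pull_map (bool_irrelevance (f_homo (lexx a)) (lexx (f a))).
exact: smap_id.
Qed.

Fact pull_map_comp (a b c : Q) (ab : (a <= b)%O) (bc : (b <= c)%O) :
  pull_map (le_trans ab bc) = (pull_map bc \o pull_map ab)%VF.
Proof. by rewrite /pull_map -smap_comp; congr smap; exact: bool_irrelevance. Qed.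

Definition pullback : pmodule k Q := PModule pull_map_id pull_map_comp.

End Pullback.

(* Limits and colimits are taken in the category of all [k]-vector spaces:
   over an infinite poset they need not be finite-dimensional. *)
Section LimitsRank.
Context (k : fieldType) (disp : Order.disp_t) (P : porderType disp).
Implicit Type M : pmodule k P.

Record cone M := Cone {
  cone_apex : lmodType k;
  cone_leg : forall p : P, {linear cone_apex -> M p};
  cone_comm : forall a b (ab : (a <= b)%O) x,
    smap M ab (cone_leg a x) = cone_leg b x
}.

Record cocone M := Cocone {
  cocone_apex : lmodType k;
  cocone_leg : forall p : P, {linear M p -> cocone_apex};
  cocone_comm : forall a b (ab : (a <= b)%O) x,
    cocone_leg b (smap M ab x) = cocone_leg a x
}.

Definition is_limit M (L : cone M) : Prop :=
  forall K : cone M,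
    let factors (u : {linear cone_apex K -> cone_apex L}) :=
      forall p x, cone_leg L p (u x) = cone_leg K p x in
    exists2 u, factors u & forall v, factors v -> v =1 u.

Definition is_colimit M (C : cocone M) : Prop :=
  forall K : cocone M,
    let factors (u : {linear cocone_apex C -> cocone_apex K}) :=
      forall p x, u (cocone_leg C p x) = cocone_leg K p x in
    exists2 u, factors u & forall v, factors v -> v =1 u.

Definition has_rank (U V : lmodType k) (f : U -> V) (r : nat) : Prop :=
  exists e : 'I_r -> V,
    (forall c : 'I_r -> k, \sum_i c i *: e i = 0 -> forall i, c i = 0) /\
    range f = [set \sum_i c i *: e i | c in [set: 'I_r -> k]].

(* Over a connected poset exactly one [r] qualifies: limits and colimits are
   unique up to isomorphism, the composite below does not depend on [p], and it
   factors through the finite-dimensional space [M p]. *)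
Definition rk M : nat :=
  xget 0%N [set r | exists (L : cone M) (C : cocone M) (p : P),
    [/\ is_limit L, is_colimit C &
        has_rank (cocone_leg C p \o cone_leg L p) r]].

End LimitsRank.

HB.instance Definition _ (disp : Order.disp_t) (P : porderType disp)
  (A : set P) := [SubChoice_isSubPOrder of {x : P | x \in A} by <: with disp].

Definition poset_interval (disp : Order.disp_t) (P : porderType disp)
    (I : set P) : Prop :=
  [/\ I !=set0,
      forall p q r, I p -> I r -> (p <= q)%O -> (q <= r)%O -> I q &
      forall p q, I p -> I q -> exists s : seq P,
        [/\ path >=<%O p s, last p s = q & forall x, x \in s -> I x]].

Section Paths.
Context (disp : Order.disp_t) (P : porderType disp).

(* The points are [p_1, .., p_n] with [n = (zlen).+1]; the [m]-th consecutive
   pair, for [m : 'I_zlen], has indices [lift ord_max m] (of value [m]) and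
   [lift ord0 m] (of value [m.+1]). *)
Record zpath := ZPath {
  zlen : nat;
  znode : 'I_zlen.+1 -> P;
  znode_comparable : forall m : 'I_zlen,
    (znode (lift ord_max m) >=< znode (lift ord0 m))%O
}.

Definition zforward (G : zpath) (m : 'I_(zlen G)) : bool :=
  (znode (lift ord_max m) <= znode (lift ord0 m))%O.

(* The index set of a path, ordered by the partial order generated by its
   arrows.  A repeated consecutive point contributes a forward arrow; the
   corresponding structure map of the pulled back module is an identity, so the
   orientation chosen there is immaterial. *)
Definition zigzag (G : zpath) : Type := 'I_(zlen G).+1.

HB.instance Definition _ (G : zpath) := Choice.on (zigzag G).

Section ZigzagOrder.
Variable G : zpath.

Definition zigzag_le (i j : zigzag G) : bool :=
  ((i <= j)%N && [forall m : 'I_(zlen G), (i <= m < j)%N ==> zforward m]) ||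
  ((j <= i)%N && [forall m : 'I_(zlen G), (j <= m < i)%N ==> ~~ zforward m]).

Lemma zigzag_leP (i j : zigzag G) :
  reflect ((i <= j)%N /\ (forall m : 'I_(zlen G), (i <= m < j)%N -> zforward m) \/
           (j <= i)%N /\ (forall m : 'I_(zlen G), (j <= m < i)%N -> ~~ zforward m))
          (zigzag_le i j).
Proof.
apply: (iffP orP) => -[].
- by case/andP=> ij /forallP h; left; split => // m; exact/implyP.
- by case/andP=> ij /forallP h; right; split => // m; exact/implyP.
- by case=> ij h; left; rewrite ij; apply/forallP => m; apply/implyP; exact: h.
- by case=> ij h; right; rewrite ij; apply/forallP => m; apply/implyP; exact: h.
Qed.


Fact zigzag_le_refl : reflexive zigzag_le.
Proof. by move=> i; apply/zigzag_leP; left; split=> // m /andP[a b]; lia. Qed.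

Fact zigzag_le_anti : antisymmetric zigzag_le.
Proof.
move=> i j /andP[/zigzag_leP h1 /zigzag_leP h2]; apply: val_inj => /=.
have no_step (a b : zigzag G) : (a < b)%N ->
    (forall m : 'I_(zlen G), (a <= m < b)%N -> zforward m) ->
    ~ (forall m : 'I_(zlen G), (a <= m < b)%N -> ~~ zforward m).
  move=> ab f nf; have mlt : (a < zlen G)%N by have := ltn_ord b; lia.
  have aab : (a <= Ordinal mlt < b)%N by rewrite /= leqnn.
  by have := nf _ aab; rewrite f.
case: (ltngtP i j) => // ij; exfalso.
- case: h1 => -[ij' f]; last by lia.
  case: h2 => -[ji nf]; first by lia.
  exact: no_step ij f nf.
- case: h1 => -[ij' f]; first by lia.
  case: h2 => -[ji nf]; last by lia.
  exact: no_step ij nf f.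
Qed.

Fact zigzag_le_trans : transitive zigzag_le.
Proof.
have no_step (a b c : zigzag G) : (a < b)%N -> (a < c)%N ->
    (forall m : 'I_(zlen G), (a <= m < b)%N -> zforward m) ->
    ~ (forall m : 'I_(zlen G), (a <= m < c)%N -> ~~ zforward m).
  move=> ab ac f nf; have mlt : (a < zlen G)%N by have := ltn_ord b; lia.
  have aab : (a <= Ordinal mlt < b)%N by rewrite /= leqnn.
  have aac : (a <= Ordinal mlt < c)%N by rewrite /= leqnn.
  by have := nf _ aac; rewrite f.
have no_step' (a b c : zigzag G) : (b < a)%N -> (c < a)%N ->
    (forall m : 'I_(zlen G), (b <= m < a)%N -> zforward m) ->
    ~ (forall m : 'I_(zlen G), (c <= m < a)%N -> ~~ zforward m).
  move=> ba ca f nf.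
  have mlt : (a.-1 < zlen G)%N by have := ltn_ord a; lia.
  have bba : (b <= Ordinal mlt < a)%N by rewrite /=; lia.
  have cca : (c <= Ordinal mlt < a)%N by rewrite /=; lia.
  by have := nf _ cca; rewrite f.
move=> j i l /zigzag_leP h1 /zigzag_leP h2; apply/zigzag_leP.
case: h1 => -[ij f]; case: h2 => -[jl g].
- left; split; first by lia.
  by move=> m im; case: (ltnP m j) => mj; [apply: f|apply: g]; lia.
- case: (ltngtP i j) => [ij'|ij'|ij']; first last.
  + by right; rewrite ij'.
  + by lia.
  case: (ltngtP l j) => [jl'|jl'|jl']; first last.
  + by left; rewrite jl'.
  + by lia.
  by case: (no_step' j i l ij' jl' f g).
- case: (ltngtP j i) => [ij'|ij'|ij']; first last.
  + by left; rewrite -ij'.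
  + by lia.
  case: (ltngtP j l) => [jl'|jl'|jl']; first last.
  + by right; rewrite -jl'.
  + by lia.
  by case: (no_step j l i jl' ij' g f).
- right; split; first by lia.
  by move=> m im; case: (ltnP m j) => mj; [apply: g|apply: f]; lia.
Qed.

End ZigzagOrder.

HB.instance Definition _ (G : zpath) := Order.Le_isPOrder.Build disp (zigzag G)
  (@zigzag_le_refl G) (@zigzag_le_anti G) (@zigzag_le_trans G).

Fact znode_homo (G : zpath) :
  {homo (@znode G : zigzag G -> P) : i j / (i <= j)%O}.
Proof.
have up (i j : 'I_(zlen G).+1) : (i <= j)%N ->
    (forall m : 'I_(zlen G), (i <= m < j)%N -> zforward m) -> (znode i <= znode j)%O.
  case: j => j jn /=; elim: j jn => [|j IH] jn ij f.
    by rewrite (_ : i = Ordinal jn)//; apply: val_inj => /=; lia.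
  move: ij; rewrite leq_eqVlt => /orP[/eqP ij|ij].
    by rewrite (_ : i = Ordinal jn)//; apply: val_inj.
  have jn' : (j < zlen G)%N by lia.
  apply: (@le_trans _ _ (znode (Ordinal (ltnW jn)))).
    by apply: IH => // m im; apply: f; lia.
  have /(f (Ordinal jn')) : (i <= Ordinal jn' < j.+1)%N by rewrite /=; lia.
  rewrite /zforward (_ : lift ord_max _ = Ordinal (ltnW jn)); last first.
    by apply: val_inj; rewrite /= /bump leqNgt jn'.
  by rewrite (_ : lift ord0 _ = Ordinal jn)//; exact: val_inj.
have down (i j : 'I_(zlen G).+1) : (j <= i)%N ->
    (forall m : 'I_(zlen G), (j <= m < i)%N -> ~~ zforward m) -> (znode i <= znode j)%O.
  case: i => i iN /=; elim: i iN => [|i IH] iN ij f.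
    by rewrite (_ : j = Ordinal iN)//; apply: val_inj => /=; lia.
  move: ij; rewrite leq_eqVlt => /orP[/eqP ij|ij].
    by rewrite (_ : j = Ordinal iN)//; apply: val_inj.
  have iN' : (i < zlen G)%N by lia.
  apply: (@le_trans _ _ (znode (Ordinal (ltnW iN)))); last first.
    by apply: IH => // m im; apply: f; lia.
  have /(f (Ordinal iN')) : (j <= Ordinal iN' < i.+1)%N by rewrite /=; lia.
  rewrite /zforward; have := znode_comparable (Ordinal iN').
  rewrite /Order.comparable => /orP[-> //|+ _].
  rewrite (_ : lift ord_max _ = Ordinal (ltnW iN)); last first.
    by apply: val_inj; rewrite /= /bump leqNgt iN'.
  by rewrite (_ : lift ord0 _ = Ordinal iN)//; exact: val_inj.
by move=> i j /zigzag_leP[[ij f]|[ij f]]; [exact: up|exact: down].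
Qed.

Definition zrestrict (k : fieldType) (M : pmodule k P) (G : zpath) :
  pmodule k (zigzag G) := pullback (@znode_homo G) M.

Definition rank_representing (k : fieldType) (G : zpath) : Prop :=
  forall M : pmodule k P, rk M = rk (zrestrict M G).

End Paths.

Section PathsInSubset.
Context (disp : Order.disp_t) (P : porderType disp).

Definition zpath_incl (A : set P) (G : zpath A) : zpath P :=
  @ZPath _ P (zlen G) (fun i => val (znode i)) (@znode_comparable _ _ G).

(* [G], a path in the ambient poset, lies in [I] and is rank-representing for
   the poset [I]. *)
Definition represents (k : fieldType) (G : zpath P) (I : set P) : Prop :=
  exists2 G' : zpath I, rank_representing k G' & G = zpath_incl G'.

Definition ZIB_rank_representing (k : fieldType) (F : set (set P)) : Prop :=
  forall I, F I -> exists G : zpath I, rank_representing k G.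

Definition ZZ (k : fieldType) (F : set (set P)) : set (zpath P) :=
  [set G | exists2 I, F I & represents k G I].

End PathsInSubset.

(* [R^d] is [ 'I_d -> R ], whose canonical order [<=%O] is pointwise. *)
Section Rd.
Context (R : realType) (d : nat).
Local Notation Rd := ('I_d -> R).

(* [`|_|] on row vectors is the sup norm. *)
Definition thickening (I : set Rd) (eps : R) : set Rd :=
  [set p | exists2 q, I q & `|\row_i (p i - q i)| <= eps].

Definition closed_under_thickenings (F : set (set Rd)) : Prop :=
  forall I (eps : R), F I -> 0 <= eps -> F (thickening I eps).

Definition diag_shift (eps : R) (a : Rd) : Rd := fun i => a i + eps.

Fact diag_shift_homo (eps : R) : {homo diag_shift eps : a b / (a <= b)%O}.
Proof. by move=> a b /lefP ab; apply/lefP => i; rewrite lerD2r; exact: ab. Qed.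

Fact le_shift2 (eps : {nonneg R}) (a : Rd) :
  (a <= diag_shift eps%:num (diag_shift eps%:num a))%O.
Proof. by apply/lefP => i; rewrite /diag_shift -addrA lerDl addr_ge0. Qed.

Context (k : fieldType).
Implicit Types M N : pmodule k Rd.

Definition shift_module (eps : R) M : pmodule k Rd :=
  pullback (@diag_shift_homo eps) M.

(* The point [a + 2 eps] is written [(a + eps) + eps], which makes
   [(shift_module eps (shift_module eps M)) a] the target on the nose. *)
Definition interleaved (eps : {nonneg R}) M N : Prop :=
  exists (alpha : pmorphism M (shift_module eps%:num N))
         (beta : pmorphism N (shift_module eps%:num M)),
    (forall a, (beta (diag_shift eps%:num a) \o alpha a)%VF =
               smap M (le_shift2 eps a)) /\
    (forall a, (alpha (diag_shift eps%:num a) \o beta a)%VF =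
               smap N (le_shift2 eps a)).

Definition interleaving_distance M N : \bar R :=
  ereal_inf [set (eps%:num)%:E | eps in [set eps | interleaved eps M N]].

(* The distance depends on a module only through the ranks of its restrictions
   to the paths of [ZZ k F]; both [I] and the path [Geps] chosen for its
   thickening range over all possibilities. *)
Definition erosion_le (F : set (set Rd)) (eps : R) M N : Prop :=
  forall G : zpath Rd, ZZ k F G ->
  forall I, F I -> represents k G I ->
  forall Geps : zpath Rd, represents k Geps (thickening I eps) ->
  (rk (zrestrict M Geps) <= rk (zrestrict N G))%N /\
  (rk (zrestrict N Geps) <= rk (zrestrict M G))%N.

Definition erosion_distance (F : set (set Rd)) M N : \bar R :=
  ereal_inf [set (eps%:num)%:E |
             eps in [set eps : {nonneg R} | erosion_le F eps%:num M N]].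

End Rd.

(* Main.v *)
From HB Require Import structures.
Require Import Defs.
From mathcomp Require Import all_boot all_order all_algebra.
From mathcomp Require Import all_classical all_reals all_analysis.
From mathcomp Require Import generic_quotient zify.

(* If [M] and [N] are [e]-interleaved through [alpha] and [beta], then for an
   interval [I] with thickening [J] the maps [M (p - e) -> N p -> M (p + e)],
   for [p] in [I], induce [lim M|J -> lim N|I] and [colim N|I -> colim M|J].
   Since [J] is connected, the canonical map of [M|J] is the composite of these
   with the canonical map of [N|I], so that [rk M|J <= rk N|I]; rank-representing
   paths turn this into the inequality of the erosion distance.  As [rk] has the
   junk value [0] when no limit or colimit exists, both have to be constructed. *)

Set Implicit Arguments.
Unset Strict Implicit.
Unset Printing Implicit Defensive.

Import Order.TTheory GRing.Theory Num.Theory.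
Import numFieldNormedType.Exports.

Local Open Scope classical_set_scope.
Local Open Scope ring_scope.

(** * Limits as spaces of compatible families *)

Section Limit.
Context (k : fieldType) (disp : Order.disp_t) (P : porderType disp).
Variable M : pmodule k P.

Definition compatible (f : forall p : P, M p) : Prop :=
  forall a b (ab : (a <= b)%O), smap M ab (f a) = f b.

Definition lim_space := {f : forall p : P, M p | compatible f}.

HB.instance Definition _ := gen_eqMixin lim_space.
HB.instance Definition _ := gen_choiceMixin lim_space.

Lemma lim_space_eq (x y : lim_space) : (forall p, sval x p = sval y p) -> x = y.
Proof.
case: x y => [x xP] [y yP] /= xy; apply: eq_exist; exact: functional_extensionality_dep.
Qed.

Fact lim_zero_subproof : compatible (fun=> 0).
Proof. by move=> a b ab; rewrite linear0. Qed.
Fact lim_opp_subproof (x : lim_space) : compatible (fun p => - sval x p).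
Proof. by move=> a b ab; rewrite linearN /= (svalP x). Qed.
Fact lim_add_subproof (x y : lim_space) :
  compatible (fun p => sval x p + sval y p).
Proof. by move=> a b ab; rewrite linearD /= (svalP x) (svalP y). Qed.
Fact lim_scale_subproof (c : k) (x : lim_space) :
  compatible (fun p => c *: sval x p).
Proof. by move=> a b ab; rewrite linearZ /= (svalP x). Qed.

Definition lim_zero : lim_space := exist _ _ lim_zero_subproof.
Definition lim_opp x : lim_space := exist _ _ (lim_opp_subproof x).
Definition lim_add x y : lim_space := exist _ _ (lim_add_subproof x y).
Definition lim_scale c x : lim_space := exist _ _ (lim_scale_subproof c x).

Fact lim_addA : associative lim_add.
Proof. by move=> x y z; apply: lim_space_eq => p /=; rewrite addrA. Qed.
Fact lim_addC : commutative lim_add.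
Proof. by move=> x y; apply: lim_space_eq => p /=; rewrite addrC. Qed.
Fact lim_add0 : left_id lim_zero lim_add.
Proof. by move=> x; apply: lim_space_eq => p /=; rewrite add0r. Qed.
Fact lim_addN : left_inverse lim_zero lim_opp lim_add.
Proof. by move=> x; apply: lim_space_eq => p /=; rewrite addNr. Qed.

HB.instance Definition _ :=
  GRing.isZmodule.Build lim_space lim_addA lim_addC lim_add0 lim_addN.

Fact lim_scaleA a b x : lim_scale a (lim_scale b x) = lim_scale (a * b) x.
Proof. by apply: lim_space_eq => p /=; rewrite scalerA. Qed.
Fact lim_scale1 : left_id 1 lim_scale.
Proof. by move=> x; apply: lim_space_eq => p /=; rewrite scale1r. Qed.
Fact lim_scaleDr : right_distributive lim_scale +%R.
Proof. by move=> a x y; apply: lim_space_eq => p /=; rewrite scalerDr. Qed.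
Fact lim_scaleDl x : {morph lim_scale^~ x : a b / a + b}.
Proof. by move=> a b; apply: lim_space_eq => p /=; rewrite scalerDl. Qed.

HB.instance Definition _ := GRing.Zmodule_isLmodule.Build k lim_space
  lim_scaleA lim_scale1 lim_scaleDr lim_scaleDl.

Definition lim_leg (p : P) (x : lim_space) : M p := sval x p.

Fact lim_leg_linear p : linear (lim_leg p).
Proof. by []. Qed.
HB.instance Definition _ p :=
  GRing.isLinear.Build k lim_space (M p) _ (lim_leg p) (lim_leg_linear p).

Definition lim_cone : cone M :=
  @Cone _ _ _ M lim_space (fun p => lim_leg p) (fun a b ab x => svalP x a b ab).

Section Lift.
Variable K : cone M.

Definition lim_lift (x : cone_apex K) : lim_space :=
  exist compatible (fun p => cone_leg K p x) (fun a b ab => cone_comm ab x).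

Fact lim_lift_linear : linear lim_lift.
Proof. by move=> c x y; apply: lim_space_eq => p; rewrite /= linearP. Qed.
HB.instance Definition _ :=
  GRing.isLinear.Build k (cone_apex K) lim_space _ lim_lift lim_lift_linear.
End Lift.

Lemma lim_coneP : is_limit lim_cone.
Proof.
move=> K /=; exists (@lim_lift K) => // v vK x.
by apply: lim_space_eq => p; exact: vK.
Qed.

End Limit.

Local Open Scope quotient_scope.

(** * Colimits as quotients of formal sums *)

Section Colimit.
Context (k : fieldType) (disp : Order.disp_t) (P : porderType disp).
Variable M : pmodule k P.

(* Elements of the colimit are represented by formal sums of vectors, two sums
   being identified when every cocone gives them the same value. *)
Definition vsum := seq {p : P & M p}.
HB.instance Definition _ := gen_eqMixin vsum.
HB.instance Definition _ := gen_choiceMixin vsum.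

Definition vsum_eval (K : cocone M) (s : vsum) : cocone_apex K :=
  \sum_(x <- s) cocone_leg K (tag x) (tagged x).

Definition vsum_rel (s t : vsum) : bool :=
  `[< forall K : cocone M, vsum_eval K s = vsum_eval K t >].

Lemma vsum_relP s t :
  reflect (forall K : cocone M, vsum_eval K s = vsum_eval K t) (vsum_rel s t).
Proof. exact: asboolP. Qed.

Fact vsum_rel_equiv : equiv_class_of vsum_rel.
Proof.
split=> [s|s t|t s u].
- exact/vsum_relP.
- by apply/vsum_relP/vsum_relP => st K; rewrite st.
- by move=> /vsum_relP st /vsum_relP tu; apply/vsum_relP => K; rewrite st tu.
Qed.

Canonical vsum_equiv : equiv_rel vsum := EquivRelPack vsum_rel_equiv.
Definition colim_space := {eq_quot vsum_equiv}.
HB.instance Definition _ := Choice.on colim_space.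

Definition cls (s : vsum) : colim_space := \pi_{eq_quot vsum_equiv} s.

Lemma cls_eq s t : (forall K, vsum_eval K s = vsum_eval K t) -> cls s = cls t.
Proof. by move=> st; apply/eqmodP/vsum_relP. Qed.

Definition colim_eval K (x : colim_space) : cocone_apex K := vsum_eval K (repr x).

Lemma colim_eval_cls K s : colim_eval K (cls s) = vsum_eval K s.
Proof.
have /eqmodP/vsum_relP : repr (cls s) = s %[mod {eq_quot vsum_equiv}].
  by rewrite reprK.
exact.
Qed.

(** Evaluations separate points because the quotient identifies exactly what all cocones identify.
    The vector space axioms below are thus checked in the apex of each cocone, where they already
    hold. *)
Lemma colim_space_eq x y : (forall K, colim_eval K x = colim_eval K y) -> x = y.
Proof.
by move=> xy; rewrite -(reprK x) -(reprK y); apply: cls_eq.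
Qed.

Definition tmap (h : forall p, M p -> M p) (s : vsum) : vsum :=
  [seq Tagged (fun p => M p) (h (tag x) (tagged x)) | x : {p : P & M p} <- s].

Definition colim_zero : colim_space := cls [::].
Definition colim_opp (x : colim_space) := cls (tmap (fun p => -%R) (repr x)).
Definition colim_add (x y : colim_space) := cls (repr x ++ repr y).
Definition colim_scale (c : k) (x : colim_space) := cls (tmap (fun p => *:%R c) (repr x)).

Lemma eval_zero K : colim_eval K colim_zero = 0.
Proof. by rewrite colim_eval_cls /vsum_eval big_nil. Qed.
Lemma eval_opp K x : colim_eval K (colim_opp x) = - colim_eval K x.
Proof.
rewrite /= colim_eval_cls /vsum_eval big_map -sumrN.
by apply: eq_bigr => y _; rewrite linearN.
Qed.
Lemma eval_scale K c x : colim_eval K (colim_scale c x) = c *: colim_eval K x.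
Proof.
rewrite /= colim_eval_cls /vsum_eval big_map /colim_eval /vsum_eval scaler_sumr.
by apply: eq_bigr => y _; rewrite /= linearZ.
Qed.
Lemma eval_add K x y : colim_eval K (colim_add x y) = colim_eval K x + colim_eval K y.
Proof. by rewrite colim_eval_cls /vsum_eval big_cat. Qed.

Let evalE := (eval_zero, eval_opp, eval_add, eval_scale).

Fact colim_addA : associative colim_add.
Proof. by move=> x y z; apply: colim_space_eq => K; rewrite !evalE addrA. Qed.
Fact colim_addC : commutative colim_add.
Proof. by move=> x y; apply: colim_space_eq => K; rewrite !evalE addrC. Qed.
Fact colim_add0 : left_id colim_zero colim_add.
Proof. by move=> x; apply: colim_space_eq => K; rewrite !evalE add0r. Qed.
Fact colim_addN : left_inverse colim_zero colim_opp colim_add.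
Proof. by move=> x; apply: colim_space_eq => K; rewrite !evalE addNr. Qed.

HB.instance Definition _ :=
  GRing.isZmodule.Build colim_space colim_addA colim_addC colim_add0 colim_addN.

Fact colim_scaleA a b x : colim_scale a (colim_scale b x) = colim_scale (a * b) x.
Proof. by apply: colim_space_eq => K; rewrite !evalE scalerA. Qed.
Fact colim_scale1 : left_id 1 colim_scale.
Proof. by move=> x; apply: colim_space_eq => K; rewrite !evalE scale1r. Qed.
Fact colim_scaleDr : right_distributive colim_scale +%R.
Proof. by move=> a x y; apply: colim_space_eq => K; rewrite !evalE scalerDr. Qed.
Fact colim_scaleDl x : {morph colim_scale^~ x : a b / a + b}.
Proof. by move=> a b; apply: colim_space_eq => K; rewrite !evalE scalerDl. Qed.

HB.instance Definition _ := GRing.Zmodule_isLmodule.Build k colim_space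
  colim_scaleA colim_scale1 colim_scaleDr colim_scaleDl.

Fact colim_eval_linear K : linear (@colim_eval K).
Proof. by move=> c x y; rewrite eval_add eval_scale. Qed.
HB.instance Definition _ K := GRing.isLinear.Build k colim_space
  (cocone_apex K) _ (@colim_eval K) (@colim_eval_linear K).

Definition colim_leg (p : P) (x : M p) : colim_space := cls [:: Tagged (fun p => M p) x].

Lemma colim_eval_leg K p x : colim_eval K (@colim_leg p x) = cocone_leg K p x.
Proof. by rewrite colim_eval_cls /vsum_eval big_seq1. Qed.

Fact colim_leg_linear p : linear (@colim_leg p).
Proof.
move=> c x y; apply: colim_space_eq => K.
by rewrite !evalE !colim_eval_leg linearP.
Qed.
HB.instance Definition _ p := GRing.isLinear.Build k (M p) colim_space _
  (@colim_leg p) (@colim_leg_linear p).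

Fact colim_leg_comm a b (ab : (a <= b)%O) x : colim_leg (smap M ab x) = colim_leg x.
Proof. by apply: colim_space_eq => K; rewrite !colim_eval_leg cocone_comm. Qed.

Definition colim_cocone : cocone M :=
  @Cocone _ _ _ M colim_space (fun p => @colim_leg p) colim_leg_comm.

(** The images of the legs span the colimit; this gives uniqueness in the universal property. *)
Lemma cls_sum s : cls s = \sum_(x <- s) colim_leg (tagged x).
Proof.
apply: colim_space_eq => K; rewrite colim_eval_cls linear_sum.
by apply: eq_bigr => x _; rewrite /= colim_eval_leg.
Qed.

Lemma colim_coconeP : is_colimit colim_cocone.
Proof.
move=> K /=; exists (@colim_eval K); first exact: colim_eval_leg.
move=> v vK x; have [s ->] : exists s, x = cls s by exists (repr x); rewrite /cls reprK.
rewrite /= colim_eval_cls cls_sum linear_sum.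
by apply: eq_bigr => y _; exact: vK.
Qed.

End Colimit.

(** * Rank of linear maps between possibly infinite-dimensional spaces *)

Section Rank.
Context (k : fieldType).

Definition independent (V : lmodType k) (r : nat) (e : 'I_r -> V) : Prop :=
  forall c : 'I_r -> k, \sum_i c i *: e i = 0 -> forall i, c i = 0.

(** If [n < m], the matrix of coefficients has more rows than columns, and a nonzero row vector in
    its left kernel is a nontrivial relation among the [e i]. *)
Lemma independent_leq (V : lmodType k) m n (e : 'I_m -> V) (g : 'I_n -> V) :
  independent e -> (forall i, exists c, e i = \sum_j c j *: g j) -> (m <= n)%N.
Proof.
move=> free_e /choice[A eA]; pose B := \matrix_(i, j) A i j.
rewrite leqNgt; apply/negP => nm.
have /rowV0Pn[v /sub_kermxP vB v0] : kermx B != 0.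
  by rewrite kermx_eq0 /row_free neq_ltn (leq_ltn_trans (rank_leq_col B) nm).
suff v00 i : v 0 i = 0 by case/eqP: v0; apply/rowP => i; rewrite mxE v00.
apply: (free_e (v 0)); under eq_bigr do rewrite eA scaler_sumr.
rewrite exchange_big big1 // => j _.
under eq_bigr do rewrite scalerA.
have vBj : \sum_i v 0 i * A i j = 0.
  have /rowP/(_ j) := vB; rewrite !mxE; apply: etrans.
  by apply: eq_bigr => l _; rewrite mxE.
by rewrite -scaler_suml vBj scale0r.
Qed.

(** The range of [f] lies in the image under [b] of the range of [f'], hence in the span of the [n]
    vectors [b (g j)]. *)
Lemma has_rank_leq (U V U' V' : lmodType k) (f : U -> V) (f' : U' -> V')
    (a : U -> U') (b : {linear V' -> V}) m n :
  (forall x, f x = b (f' (a x))) -> has_rank f m -> has_rank f' n -> (m <= n)%N.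
Proof.
move=> fE [e [free_e fe]] [g [_ f'g]].
apply: (@independent_leq _ m n e (fun j => b (g j))) => // i.
have [x _ xi] : range f (e i).
  rewrite fe; exists (fun j => (j == i)%:R) => //.
  by rewrite (bigD1 i) //= eqxx scale1r big1 ?addr0 // => j /negbTE->; rewrite scale0r.
have : range f' (f' (a x)) by exists (a x).
rewrite f'g => -[c _ cE]; exists c.
rewrite -xi fE -cE linear_sum; apply: eq_bigr => j _; exact: linearZ.
Qed.

(** Take the largest number of vectors of [U] with independent images. It is bounded by the
    dimension of [W], since all images lie in the span of [h] applied to a basis of [W]; by
    maximality these images span the range. *)
Lemma has_rank_exists (U V : lmodType k) (W : vectType k)
    (g : {linear U -> W}) (h : {linear W -> V}) : exists r, has_rank (h \o g) r.
Proof.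
pose indep r := exists e : 'I_r -> U, independent (h \o g \o e).
have indep0 : `[< indep 0 >] by apply/asboolP; exists (fun=> 0) => c _ [].
have indep_le r : `[< indep r >] -> (r <= \dim {:W})%N.
  move=> /asboolP[e free_e].
  apply: (@independent_leq V _ _ (h \o g \o e) (fun j => h (vbasis {:W})`_j)) => // i.
  exists (fun j => coord (vbasis {:W}) j (g (e i))).
  rewrite /= {1}(coord_vbasis (memvf (g (e i)))) linear_sum.
  by apply: eq_bigr => j _; exact: linearZ.
have ex_indep : exists r, `[< indep r >] by exists 0%N.
case: (ex_maxnP ex_indep indep_le) => r /asboolP[e free_e] max_r.
exists r, (h \o g \o e); split=> //; apply/seteqP; split; last first.
  move=> _ [c _ <-]; exists (\sum_i c i *: e i) => //=.
  rewrite !linear_sum; apply: eq_bigr => i _ /=.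
  by rewrite !linearZ.
move=> _ [u _ <-]; apply: contrapT => nu.
have /max_r : `[< indep r.+1 >]; last by rewrite ltnn.
(* The family [e] with [u] put in front, at index [ord0], would contradict maximality. *)
apply/asboolP; exists (fun i => oapp e u (unlift ord0 i)) => c.
rewrite big_ord_recl /= unlift_none /=; under eq_bigr do rewrite liftK /=.
move=> c0; have c00 : c ord0 = 0.
  (* With a nonzero coefficient at [u], the relation can be solved for the image of [u], which would
     then lie in the span. *)
  apply: contra_notP nu => /eqP cn0.
  exists (fun i => - (c ord0)^-1 * c (lift ord0 i)) => //=.
  under eq_bigr do rewrite -scalerA.
  move/eqP: c0; rewrite -scaler_sumr addrC addr_eq0 => /eqP->.
  by rewrite scalerN scaleNr opprK scalerA mulVf ?scale1r.
move: c0; rewrite c00 scale0r add0r => /free_e c1 i.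
by case: (unliftP ord0 i) => [j ->|->].
Qed.

End Rank.

(** * Connected posets and the canonical map *)

(** Connectedness in the form of an induction principle: a property invariant under comparability
    spreads from one point to all, without handling chains. *)
Definition order_connected (disp : Order.disp_t) (P : porderType disp) : Prop :=
  forall S : set P, (forall a b, (a <= b)%O -> S a <-> S b) ->
  forall a b, S a -> S b.

Lemma canonical_map_indep (k : fieldType) (disp : Order.disp_t)
    (P : porderType disp) (M : pmodule k P) (L : cone M) (C : cocone M) p q x :
  order_connected P ->
  cocone_leg C p (cone_leg L p x) = cocone_leg C q (cone_leg L q x).
Proof.
move/(_ [set q | cocone_leg C p (cone_leg L p x) = cocone_leg C q (cone_leg L q x)]).
apply=> // a b ab /=.
by rewrite -(cone_comm ab x) cocone_comm.
Qed.

(** The explicit limit and colimit, with a finite rank because the composite passes through [M p0],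
    rule out the default value [0] in [rk]. *)
Lemma rk_attained (k : fieldType) (disp : Order.disp_t) (P : porderType disp)
    (M : pmodule k P) (p0 : P) :
  exists (L : cone M) (C : cocone M) (p : P),
    [/\ is_limit L, is_colimit C &
        has_rank (cocone_leg C p \o cone_leg L p) (rk M)].
Proof.
have [r rP] := has_rank_exists (cone_leg (lim_cone M) p0)
  (cocone_leg (colim_cocone M) p0).
rewrite /rk; case: xgetP => [_ -> //|/(_ r)[]].
exists  (lim_cone M), (colim_cocone M), p0; split=> //.
- exact: lim_coneP.
- exact: colim_coconeP.
Qed.

(** * Rank comparison for a structure map factored through another module *)

Section Factorization.
Context (k : fieldType) (disp disp' : Order.disp_t).
Context (P : porderType disp) (Q : porderType disp').
Variables (M : pmodule k P) (N : pmodule k Q) (a b : Q -> P).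
Hypothesis a_homo : {homo a : x y / (x <= y)%O}.
Hypothesis b_homo : {homo b : x y / (x <= y)%O}.
Hypothesis ab : forall q, (a q <= b q)%O.
Variable alpha : pmorphism (pullback a_homo M) N.
Variable beta : pmorphism N (pullback b_homo M).
Hypothesis beta_alpha :
  forall q, (beta q \o alpha q)%VF = smap M (ab q).

Fact push_cone_comm (L : cone M) p q (pq : (p <= q)%O) x :
  smap N pq ((alpha p \o cone_leg L (a p)) x) = (alpha q \o cone_leg L (a q)) x.
Proof.
rewrite /= -(cone_comm (a_homo pq)) -!comp_lfunE.
by congr (fun_of_lfun _ _); rewrite -(pmor_nat alpha pq).
Qed.

Definition push_cone (L : cone M) : cone N :=
  @Cone _ _ _ N (cone_apex L) (fun q => alpha q \o cone_leg L (a q))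
    (@push_cone_comm L).

Fact pull_cocone_comm (C : cocone M) p q (pq : (p <= q)%O) x :
  (cocone_leg C (b q) \o beta q) (smap N pq x) = (cocone_leg C (b p) \o beta p) x.
Proof.
rewrite /= -(cocone_comm _ (b_homo pq)); congr (cocone_leg C _ _).
by rewrite -!comp_lfunE (pmor_nat beta pq).
Qed.

Definition pull_cocone (C : cocone M) : cocone N :=
  @Cocone _ _ _ N (cocone_apex C) (fun q => cocone_leg C (b q) \o beta q)
    (@pull_cocone_comm C).

(* The canonical map of [M] factors through the canonical map of [N]:
   [lim M -> lim N -> colim N -> colim M]. *)
Lemma rk_leq : order_connected P -> Q -> (rk M <= rk N)%N.
Proof.
move=> P_conn q0.
have [L [C [p [_ _ rM]]]] := rk_attained M (a q0).
have [L' [C' [q [limL' colimC' rN]]]] := rk_attained N q0.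
have [u uE _] := limL' (push_cone L).
have [v vE _] := colimC' (pull_cocone C).
apply: (has_rank_leq (a := u) (b := v) _ rM rN) => x /=.
(* The detour through [N q] is the structure map from [a q] to [b q], which the cocone absorbs. What
   remains is the canonical map at [a q] instead of [p]. *)
rewrite vE uE /= -[beta q _]comp_lfunE beta_alpha cocone_comm.
exact: canonical_map_indep.
Qed.

End Factorization.

(** * Commuting structure maps; connectedness of zigzags *)

Lemma smap_irrelevance (k : fieldType) (disp : Order.disp_t)
    (P : porderType disp) (M : pmodule k P) a b (ab ab' : (a <= b)%O) :
  smap M ab = smap M ab'.
Proof. by congr smap; exact: bool_irrelevance. Qed.

Lemma smap_square (k : fieldType) (disp : Order.disp_t)
    (P : porderType disp) (M : pmodule k P) a b b' c
    (ab : (a <= b)%O) (bc : (b <= c)%O) (ab' : (a <= b')%O) (b'c : (b' <= c)%O) :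
  (smap M bc \o smap M ab)%VF = (smap M b'c \o smap M ab')%VF.
Proof. by rewrite -!smap_comp; exact: smap_irrelevance. Qed.

(** Consecutive indices are comparable in the direction of their arrow, so membership in [S]
    propagates from [ord0] by induction on the index. *)
Lemma zigzag_connected (disp : Order.disp_t) (P : porderType disp)
    (G : zpath P) : order_connected (zigzag G).
Proof.
move=> S Sle; suff S0 i : S ord0 <-> S i.
  by move=> a b Sa; apply/(S0 b)/(S0 a).
case: i; elim=> [|i IH] ilt; first by rewrite (_ : ord0 = Ordinal ilt) //; apply: val_inj.
apply: (iff_trans (IH (ltnW ilt))).
pose m : 'I_(zlen G) := Ordinal (ilt : (i < zlen G)%N).
have [fm|bm] := boolP (zforward m).
- apply: Sle; apply/zigzag_leP; left; split=> //= l il.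
  by rewrite (_ : l = m) //; apply: val_inj => /=; lia.
- apply: iff_sym; apply: Sle; apply/zigzag_leP; right; split=> //= l il.
  by rewrite (_ : l = m) //; apply: val_inj => /=; lia.
Qed.

(** * Restriction to subsets and to paths inside them *)

Section Restriction.
Context (k : fieldType) (disp : Order.disp_t) (P : porderType disp).

Fact set_val_homo (A : set P) : {homo (val : A -> P) : x y / (x <= y)%O}.
Proof. by []. Qed.

Definition restriction (A : set P) (M : pmodule k P) : pmodule k A :=
  pullback (@set_val_homo A) M.

(** The chain joining two points stays in [I], so each of its steps is a comparison in the subposet
    and carries [S] along. *)
Lemma interval_connected (I : set P) :
  poset_interval I -> order_connected (set_type I : porderType disp).
Proof.
move=> [_ _ I_path] S Sle x y Sx.
have [s [xs sy sI]] := I_path _ _ (set_valP x) (set_valP y).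
elim: s x Sx xs sy sI => [|z s IH] x Sx /=.
  by move=> _ xy _; rewrite (_ : y = x) //; apply: val_inj.
move=> /andP[xz zs] sy sI; have zI : z \in I by rewrite inE; apply: sI; rewrite mem_head.
apply: (IH (exist _ z zI)) => //; last by move=> t ts; apply: sI; rewrite in_cons ts orbT.
by case/orP: xz => [xz|zx]; [apply/(Sle x) | apply/(Sle _ x)].
Qed.

(* The two modules live on index posets that differ only by the proofs of the
   order axioms; they are compared by identity maps. *)
Lemma rk_zrestrict_incl (A : set P) (M : pmodule k P) (G : zpath A) :
  rk (zrestrict M (zpath_incl G)) = rk (zrestrict (restriction A M) G).
Proof.
pose G1 := zpath_incl G.
pose f : zigzag G -> zigzag G1 := id; pose g : zigzag G1 -> zigzag G := id.
have f_homo : {homo f : x y / (x <= y)%O} by [].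
have g_homo : {homo g : x y / (x <= y)%O} by [].
pose M1 := zrestrict M G1; pose M2 := zrestrict (restriction A M) G.
have to2 a b (ab : (a <= b)%O) :
    (\1 \o smap (pullback f_homo M1) ab)%VF = (smap M2 ab \o \1)%VF.
  rewrite comp_lfun1l comp_lfun1r; exact: (smap_irrelevance M).
have of2 a b (ab : (a <= b)%O) :
    (\1 \o smap M2 ab)%VF = (smap (pullback f_homo M1) ab \o \1)%VF.
  rewrite comp_lfun1l comp_lfun1r; exact: (smap_irrelevance M).
have to1 a b (ab : (a <= b)%O) :
    (\1 \o smap (pullback g_homo M2) ab)%VF = (smap M1 ab \o \1)%VF.
  rewrite comp_lfun1l comp_lfun1r; exact: (smap_irrelevance M).
have of1 a b (ab : (a <= b)%O) :
    (\1 \o smap M1 ab)%VF = (smap (pullback g_homo M2) ab \o \1)%VF.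
  rewrite comp_lfun1l comp_lfun1r; exact: (smap_irrelevance M).
apply/eqP; rewrite eqn_leq; apply/andP; split.
- apply: (@rk_leq _ _ _ _ _ M1 M2 f f f_homo f_homo (fun=> lexx _)
    (@PMorphism _ _ _ (pullback f_homo M1) M2 (fun=> \1%VF) to2)
    (@PMorphism _ _ _ M2 (pullback f_homo M1) (fun=> \1%VF) of2)).
  + by move=> q; rewrite comp_lfun1l smap_id.
  + exact: zigzag_connected.
  + exact: (ord0 : zigzag G1).
- apply: (@rk_leq _ _ _ _ _ M2 M1 g g g_homo g_homo (fun=> lexx _)
    (@PMorphism _ _ _ (pullback g_homo M2) M1 (fun=> \1%VF) to1)
    (@PMorphism _ _ _ M1 (pullback g_homo M2) (fun=> \1%VF) of1)).
  + by move=> q; rewrite comp_lfun1l smap_id.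
  + exact: zigzag_connected.
  + exact: (ord0 : zigzag G1).
Qed.

End Restriction.

(** * Thickenings, interleavings and the erosion inequality *)

Section Erosion.
Context (R : realType) (d : nat) (k : fieldType).
Local Notation Rd := ('I_d -> R).
Implicit Types (M N : pmodule k Rd) (I : set Rd).

Lemma thickening_diag_shift I (e c : R) p :
  `|c| <= e -> I p -> thickening I e (diag_shift c p).
Proof.
move=> ce Ip; exists p => //.
(* The sup norm is a maximum starting from [0], so [0 <= e] must be checked besides the
   coordinates. *)
rewrite [leLHS]mx_normrE; apply: bigmax_le => [|i _]; first exact: le_trans ce.
by rewrite mxE /diag_shift addrAC subrr add0r.
Qed.

Lemma diag_shiftNK (e : R) (p : Rd) : diag_shift e (diag_shift (- e) p) = p.
Proof. by apply/funext => i; rewrite /diag_shift addrNK. Qed.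

Lemma interleaved_sym (e : {nonneg R}) M N : interleaved e M N -> interleaved e N M.
Proof. by case=> alpha [beta [ba ab]]; exists beta, alpha. Qed.

Lemma rk_restriction_thickening I (e : {nonneg R}) M N :
  I !=set0 -> poset_interval (thickening I e%:num) -> interleaved e M N ->
  (rk (restriction (thickening I e%:num) M) <= rk (restriction I N))%N.
Proof.
move=> [p0 Ip0] J_int [alpha [beta [ba _]]].
set J := thickening I e%:num in J_int *.
have I_sub (c : R) (p : I) : `|c| <= e%:num -> diag_shift c (val p) \in J.
  by move=> ce; rewrite inE; apply: thickening_diag_shift => //; exact: set_valP.
have downP (p : I) : diag_shift (- e%:num) (val p) \in J.
  by apply: I_sub; rewrite normrN ger0_norm.
have upP (p : I) : diag_shift e%:num (val p) \in J.
  by apply: I_sub; rewrite ger0_norm.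
pose down (p : I) : J := exist (fun x => x \in J) _ (downP p).
pose up (p : I) : J := exist (fun x => x \in J) _ (upP p).
have down_homo : {homo down : p q / (p <= q)%O}.
  by move=> p q pq; exact: (diag_shift_homo (- e%:num) pq).
have up_homo : {homo up : p q / (p <= q)%O}.
  by move=> p q pq; exact: (diag_shift_homo e%:num pq).
(* [alpha] at [p - e] lands in [N] at [(p - e) + e], a point equal to [p] but not convertible to it.
   The structure map of [N] along this inequality replaces a transport. *)
have shift_le (p : Rd) : (diag_shift e%:num (diag_shift (- e%:num) p) <= p)%O.
  by rewrite diag_shiftNK.
have down_up (p : I) : (down p <= up p)%O.
  by apply/lefP => i; rewrite /= /diag_shift lerD2l -subr_ge0 opprK addr_ge0.
pose M' := restriction J M; pose N' := restriction I N.
have alphaP p q (pq : (p <= q)%O) :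
    ((smap N (shift_le (val q)) \o alpha (val (down q))) \o
       smap (pullback down_homo M') pq)%VF =
    (smap N' pq \o (smap N (shift_le (val p)) \o alpha (val (down p))))%VF.
  have dpq : (val (down p) <= val (down q))%O := down_homo _ _ pq.
  rewrite -comp_lfunA.
  rewrite (_ : smap (pullback down_homo M') pq = smap M dpq);
    last exact: (smap_irrelevance M).
  rewrite (pmor_nat alpha dpq).
  rewrite !comp_lfunA; congr (_ \o _)%VF.
  (* Both sides are composites of structure maps of [N] from [(p - e) + e] to [q]. *)
  exact: (smap_square N).
have betaP p q (pq : (p <= q)%O) :
    (beta (val q) \o smap N' pq)%VF =
    (smap (pullback up_homo M') pq \o beta (val p))%VF.
  have vpq : (val p <= val q)%O := pq.
  rewrite (_ : smap N' pq = smap N vpq); last exact: (smap_irrelevance N).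
  rewrite (pmor_nat beta vpq); congr (_ \o _)%VF.
  exact: (smap_irrelevance M).
pose alpha' := @PMorphism _ _ _ (pullback down_homo M') N'
  (fun p => smap N (shift_le (val p)) \o alpha (val (down p)))%VF alphaP.
pose beta' := @PMorphism _ _ _ N' (pullback up_homo M') (fun p => beta (val p)) betaP.
apply: (@rk_leq _ _ _ _ _ M' N' down up down_homo up_homo down_up alpha' beta').
- move=> p /=; rewrite comp_lfunA.
  (* Naturality moves [beta] past the correction to meet [alpha] at [p - e]; the interleaving
     identity then leaves only structure maps of [M], from [p - e] to [p + e]. *)
  rewrite (pmor_nat beta (shift_le (val p))) -comp_lfunA ba.
  rewrite -smap_comp; exact: smap_irrelevance.
- exact: interval_connected.
- exact: (exist _ p0 (mem_set Ip0)).
Qed.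

Lemma erosion_le_interleaved (F : set (set Rd)) (e : {nonneg R}) M N :
  (forall I, F I -> poset_interval I) -> closed_under_thickenings F ->
  interleaved e M N -> erosion_le F e%:num M N.
Proof.
move=> F_int F_thick MN G _ I FI [G' G'I ->] Ge [Ge' Ge'J ->].
(* Rank-representation trades the paths for the restrictions to [I] and to its thickening. *)
rewrite !rk_zrestrict_incl -!G'I -!Ge'J.
have [I0 _ _] := F_int _ FI.
have J_int : poset_interval (thickening I e%:num) by apply: F_int; exact: F_thick.
by split; apply: rk_restriction_thickening => //; exact: interleaved_sym.
Qed.

End Erosion.

Theorem theorem9 (k : fieldType) (R : realType) (d : nat)
  (F : set (set ('I_d -> R)))
  (F_intervals : forall I, F I -> poset_interval I)
  (F_thick : closed_under_thickenings F)
  (F_zib : ZIB_rank_representing k F)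
  (M N : pmodule k ('I_d -> R)) :
  (erosion_distance F M N <= interleaving_distance M N)%E.
Proof.
(* Every interleaving parameter is admissible for erosion, and the infimum over a larger set is
   smaller. *)
apply: ereal_inf_le_tmp => _ [e eMN <-]; exists e => //.
exact: erosion_le_interleaved.
Qed.
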